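(* Let $\overline{p_o}(n)$ denote the number of overpartitions of $n$ into odd parts, and let $E(n),E_0(n),E_1(n),E_2(n),E_3(n)$ be as defined in the context. Then: (a) For every nonnegative integer $n$, $E(n)=\overline{p_o}(n)$. For every positive integer $n$: (b) $E_0(n)=\frac{\overline{p_o}(n)}{2}+1$ if $n$ is a perfect square, and $E_0(n)=\frac{\overline{p_o}(n)}{2}$ otherwise; (c) $E_1(n)=\frac{\overline{p_o}(n)}{2}-1$ if $n$ is a perfect square, and $E_1(n)=\frac{\overline{p_o}(n)}{2}$ otherwise; (d) $E_2(n)=\frac{\overline{p_o}(n)}{2}+(-1)^n$ if $n$ is a perfect square, and $E_2(n)=\frac{\overline{p_o}(n)}{2}$ otherwise; (e) $E_3(n)=\frac{\overline{p_o}(n)}{2}-(-1)^n$ if $n$ is a perfect square, and $E_3(n)=\frac{\overline{p_o}(n)}{2}$ otherwise.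
   Context: An overpartition of $n$ is a partition of $n$ in which the first occurrence of each part size may be overlined; $\overline{p_o}(n)$ counts overpartitions of $n$ all of whose parts are odd, so $\sum_{n\ge0}\overline{p_o}(n)q^n=\frac{(-q;q^2)_\infty}{(q;q^2)_\infty}$, where $(a;q)_\infty=\prod_{j\ge0}(1-aq^j)$. A two-color partition of $n$ is a partition of $n$ in which each part is colored blue or green (a part $\lambda$ in blue is written $\lambda_b$, in green $\lambda_g$); the same integer may appear in both colors. $E(n)$ is the number of two-color partitions of $n$ in which parts are distinct (no integer appears twice in the same color) and every even part is blue (odd parts may be blue or green). Thus $\sum_{n\ge0}E(n)q^n=(-q^2;q^2)_\infty(-q;q^2)_\infty^2$. $E_0(n)$ (resp. $E_1(n)$) is the number of partitions counted by $E(n)$ whose number of even parts is even (resp. odd); $E_2(n)$ (resp. $E_3(n)$) is the number of partitions counted by $E(n)$ whose total number of parts (of both colors) is even (resp. odd). *)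

(* Defs.v *)
From mathcomp Require Import all_boot all_order all_algebra.

Set Implicit Arguments.
Unset Strict Implicit.
Unset Printing Implicit Defensive.

(* A part together with a two-valued mark: overlined or not for
   overpartitions, blue or green for two-color partitions. *)
Definition mpart : Type := (nat * bool)%type.

Definition parts_of (n : nat) (s : seq mpart) : bool :=
  all (fun x : mpart => 0 < x.1) s && (sumn [seq x.1 | x <- s] == n).

(* The number of sequences of marked parts that satisfy P, among those having
   at most n entries, each with a part of size at most n.  By parts_of_decode
   and decode_inj below, this is the number of all sequences satisfying P
   whenever P implies parts_of n. *)
Definition decode (n : nat) (t : n.-bseq ('I_n.+1 * bool)) : seq mpart :=
  [seq (val x.1, x.2) | x <- t].

Definition count_marked (n : nat) (P : pred (seq mpart)) : nat :=
  #|[set t : n.-bseq ('I_n.+1 * bool) | P (decode t)]|.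

Lemma decode_inj (n : nat) : injective (@decode n).
Proof.
move=> t u /inj_map tu; apply/val_inj/tu.
by move=> [i a] [j b] [/val_inj -> ->].
Qed.

Lemma parts_of_decode (n : nat) (s : seq mpart) :
  parts_of n s -> exists t : n.-bseq ('I_n.+1 * bool), decode t = s.
Proof.
case/andP=> s_gt0 /eqP sum_s.
have size_s : size s <= n.
  rewrite -{}sum_s; elim: s s_gt0 => //= x s IHs /andP[x_gt0 /IHs le_s].
  by rewrite -add1n leq_add.
have le_n (x : mpart) : x \in s -> x.1 < n.+1.
  rewrite ltnS -{}sum_s => {s_gt0 size_s}.
  elim: s => //= y s IHs; rewrite inE => /predU1P[<- | /IHs le_x].
    exact: leq_addr.
  exact: leq_trans le_x (leq_addl _ _).
pose f (x : mpart) : 'I_n.+1 * bool := (inord x.1, x.2).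
have size_t : size (map f s) <= n by rewrite size_map.
exists (Bseq size_t); rewrite /decode /= -map_comp -[RHS]map_id.
by apply/eq_in_map=> -[a b] /le_n lt_a /=; rewrite inordK.
Qed.

(* Overpartitions: the mark true means "overlined"; the parts are listed in
   weakly decreasing order, and an overlined part is not preceded by an equal
   part. *)
Definition is_overpartition (n : nat) (s : seq mpart) : bool :=
  [&& parts_of n s,
      sorted geq [seq x.1 | x <- s] &
      pairwise (fun x y : mpart => y.2 ==> (x.1 != y.1)) s].

Definition pobar (n : nat) : nat :=
  count_marked n (fun s => is_overpartition n s &&
                           all (fun x : mpart => odd x.1) s).

(* Two-color partitions: the mark is the color.  Each multiset of colored
   parts is represented by its unique weakly decreasing listing for the total
   order 1_g < 1_b < 2_g < 2_b < ... *)
Definition blue : bool := true.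
Definition green : bool := false.

Definition mpart_ge (x y : mpart) : bool :=
  (y.1 < x.1) || ((x.1 == y.1) && ((x.2 == blue) || (y.2 == green))).

Definition is_two_color_partition (n : nat) (s : seq mpart) : bool :=
  parts_of n s && sorted mpart_ge s.

Definition is_E_partition (n : nat) (s : seq mpart) : bool :=
  [&& is_two_color_partition n s,
      uniq s &
      all (fun x : mpart => ~~ odd x.1 ==> (x.2 == blue)) s].

Definition num_even_parts (s : seq mpart) : nat :=
  count (fun x : mpart => ~~ odd x.1) s.

Definition E (n : nat) : nat := count_marked n (is_E_partition n).

Definition E0 (n : nat) : nat :=
  count_marked n (fun s => is_E_partition n s && ~~ odd (num_even_parts s)).

Definition E1 (n : nat) : nat :=
  count_marked n (fun s => is_E_partition n s && odd (num_even_parts s)).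

Definition E2 (n : nat) : nat :=
  count_marked n (fun s => is_E_partition n s && ~~ odd (size s)).

Definition E3 (n : nat) : nat :=
  count_marked n (fun s => is_E_partition n s && odd (size s)).

Definition perfect_square (n : nat) : Prop := exists k : nat, n = k ^ 2.

(* Main.v *)
Require Import Defs.
From mathcomp Require Import all_boot all_order all_algebra.
From mathcomp Require Import zify ring lra.

Import GRing.Theory.
Local Open Scope ring_scope.

(** By Euler, (-q;q)(q;q^2) = 1, so the generating function
    (-q^2;q^2)(-q;q^2)^2 = (-q;q)(-q;q^2) of E equals (-q;q^2)/(q;q^2), that of
    overpartitions into odd parts.  Counting even parts with sign gives
    (q^2;q^2)(-q;q^2)^2, which is the sum of the q^(k^2) over all integers k by
    the Jacobi triple product; hence E0 - E1 is 2 at positive squares and 0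
    elsewhere.  As size s = weight s + num_even_parts s modulo 2, E2 and E3 are
    E0 and E1, swapped when n is odd.  The power series identities are proved
    as congruences modulo 'X^m between finite products, the triple product
    being obtained from the q-binomial theorem. *)

(** * Counting by explicit lists built one part size at a time *)

Definition weight (s : seq mpart) : nat := sumn [seq x.1 | x <- s].

(** Through the injective [decode], the bounded sequences satisfying [P] correspond to the members
    of [L] satisfying [P]. The list only has to cover the solutions; it may contain other
    sequences. *)
Lemma count_marked_enum (n : nat) (P : pred (seq mpart)) (L : seq (seq mpart)) :
  uniq L -> (forall s, P s -> parts_of n s) -> (forall s, P s -> s \in L) ->
  count_marked n P = count P L.
Proof.
move=> uL Pn PL; rewrite /count_marked cardE -(size_map (@decode n)) -size_filter.
apply/perm_size/uniq_perm.
- by rewrite map_inj_uniq ?enum_uniq //; exact: decode_inj.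
- exact: filter_uniq.
move=> s; rewrite mem_filter; apply/mapP/andP => [[t]|[Ps _]].
  by rewrite mem_enum inE => Pt ->; split=> //; exact: PL.
by have [t ts] := parts_of_decode (Pn _ Ps); exists t; rewrite // mem_enum inE ts.
Qed.

(* B i lists the admissible blocks of parts of size i; the sequences obtained
   have parts at most N, in weakly decreasing order. *)
Fixpoint layered (B : nat -> seq (seq mpart)) (N : nat) : seq (seq mpart) :=
  if N is N'.+1 then [seq b ++ r | b <- B N, r <- layered B N'] else [:: [::]].

Definition homogeneous (i : nat) (b : seq mpart) : bool := all (fun x => x.1 == i) b.

Section Layered.
Context {B : nat -> seq (seq mpart)}.
Hypothesis B_homog : forall i b, b \in B i -> homogeneous i b.

Lemma layered_le N s : s \in layered B N -> all (fun x => 0 < x.1 <= N)%N s.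
Proof.
elim: N s => [|N IHN] s /=; first by rewrite inE => /eqP->.
case/allpairsP=> -[b r] /= [/B_homog bN /IHN rN ->]; rewrite all_cat.
apply/andP; split; first by apply: sub_all bN => x /eqP ->; rewrite leqnn.
by apply: sub_all rN => x /andP[-> /leqW].
Qed.

(** A concatenation determines its pieces: filtering by size [N.+1] recovers the top block, and the
    complementary filter recovers the rest. *)
Lemma layered_uniq N : (forall i, uniq (B i)) -> uniq (layered B N).
Proof.
move=> uB; elim: N => //= N IHN; apply: allpairs_uniq => //.
have splitE b r : b \in B N.+1 -> r \in layered B N ->
    [seq x <- b ++ r | x.1 == N.+1] = b /\ [seq x <- b ++ r | x.1 != N.+1] = r.
  move=> /B_homog bN /layered_le rN; rewrite !filter_cat.
  have [rN1 rN0] : all (fun x => x.1 != N.+1) r /\ all (fun x => ~~ (x.1 != N.+1)) b.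
    split; first by apply: sub_all rN => x /andP[_ xN]; rewrite neq_ltn ltnS xN.
    by apply: sub_all bN => x; rewrite negbK.
  split.
    rewrite (all_filterP bN) (_ : filter _ r = [::]) ?cats0 //.
    by apply/eqP; rewrite -(negbK (_ == _)) -has_filter -all_predC rN1.
  rewrite (all_filterP rN1) (_ : filter _ b = [::]) //.
  by apply/eqP; rewrite -(negbK (_ == _)) -has_filter -all_predC rN0.
move=> _ _ /allpairsP[[b r] /= [bB rL ->]] /allpairsP[[c t] /= [cB tL ->]] /= eq_cat.
have := splitE _ _ bB rL; rewrite eq_cat.
by have [-> ->] := splitE _ _ cB tL; case=> -> ->.
Qed.

(** Blocks are chosen independently for each size, so the sum over all choices factors by
    distributivity. *)
Lemma sum_layered (R : comPzRingType) (u : mpart -> R) N :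
  \sum_(s <- layered B N) \prod_(x <- s) u x =
  \prod_(i < N) \sum_(b <- B i.+1) \prod_(x <- b) u x.
Proof.
elim: N => [|N IHN]; first by rewrite big_seq1 big_nil big_ord0.
rewrite big_ord_recr /= -IHN mulrC big_allpairs_dep big_distrl /=.
apply: eq_bigr => b _; rewrite big_distrr /=.
by apply: eq_bigr => r _; rewrite big_cat.
Qed.

Variable R : rel mpart.
Hypothesis R_lt : forall x y : mpart, (y.1 < x.1)%N -> R x y.

Lemma layered_pairwise N s :
  (forall i b, b \in B i -> pairwise R b) -> s \in layered B N -> pairwise R s.
Proof.
move=> pB; elim: N s => [|N IHN] s /=; first by rewrite inE => /eqP->.
case/allpairsP=> -[b r] /= [bB rL ->]; rewrite pairwise_cat (pB _ _ bB) (IHN _ rL) !andbT.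
apply/allrelP => x y /(allP (B_homog _ _ bB)) /eqP xN /(allP (layered_le _ _ rL)).
by case/andP=> _ yN; apply: R_lt; rewrite xN.
Qed.

Lemma layered_all (D : pred mpart) N s :
  (forall i b, b \in B i -> all D b) -> s \in layered B N -> all D s.
Proof.
move=> pB; elim: N s => [|N IHN] s /=; first by rewrite inE => /eqP->.
by case/allpairsP=> -[b r] /= [bB rL ->]; rewrite all_cat (pB _ _ bB) (IHN _ rL).
Qed.

Hypothesis R_le : forall x y : mpart, R x y -> (y.1 <= x.1)%N.

Lemma pairwise_split N s : pairwise R s -> all (fun x => x.1 <= N.+1)%N s ->
  s = [seq x <- s | x.1 == N.+1] ++ [seq x <- s | x.1 <= N]%N.
Proof.
elim: s => //= x s IHs /andP[xs ps] /andP[xN sN].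
case: eqP => [->|/eqP xN']; first by rewrite ltnn /= -IHs.
have {}xN : (x.1 <= N)%N by rewrite -ltnS ltn_neqAle xN'.
have sxN : all (fun y => y.1 <= N)%N s.
  by apply: sub_all xs => y /R_le yx; exact: leq_trans yx xN.
rewrite xN (all_filterP sxN) (_ : filter _ s = [::]) //.
apply/eqP; rewrite -(negbK (_ == _)) -has_filter -all_predC.
by apply: sub_all sxN => y /= yN; rewrite neq_ltn ltnS yN.
Qed.

(** In a decreasing sequence the parts of maximal size form a prefix, which is the top block;
    induction treats the rest. The bound [m] allows finite block lists even when a size may
    repeat. *)
Lemma mem_layered (D : pred mpart) m N s :
    (forall i b, homogeneous i b -> pairwise R b -> all D b -> (size b <= m)%N ->
       (0 < i)%N -> b \in B i) ->
  pairwise R s -> all D s -> all (fun x => 0 < x.1 <= N)%N s -> (size s <= m)%N ->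
  s \in layered B N.
Proof.
move=> hB; elim: N s => [|N IHN] s ps Ds sN sm.
  by case: s sN {ps Ds sm} => //= x s /andP[/andP[]]; case: x.1.
have sN1 : all (fun x => x.1 <= N.+1)%N s by apply: sub_all sN => x /andP[].
rewrite (pairwise_split _ _ ps sN1); apply/allpairsP => /=.
exists ([seq x <- s | x.1 == N.+1], [seq x <- s | (x.1 <= N)%N]) => /=.
have szf a : (size (filter a s) <= m)%N.
  by rewrite size_filter (leq_trans (count_size _ _)).
split=> //.
  apply: hB => //; [exact: filter_all|exact: pairwise_filter|].
  by rewrite all_filter; apply: sub_all Ds => x Dx; apply/implyP.
apply: IHN => //; first exact: pairwise_filter.
  by rewrite all_filter; apply: sub_all Ds => x Dx; apply/implyP.
by rewrite all_filter; apply: sub_all sN => x /andP[x0 _]; apply/implyP => /= ->; rewrite x0.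
Qed.

End Layered.

(** * Signed generating polynomials *)

(** [c] selects the parts that carry a sign: [pred0] gives plain counts, the even parts give the
    difference of [E0] and [E1]. *)
Definition monomial (c : pred mpart) (x : mpart) : {poly rat} :=
  (-1) ^+ c x *: 'X^(x.1).

Lemma prod_monomial c s :
  \prod_(x <- s) monomial c x = (-1) ^+ count c s *: 'X^(weight s).
Proof.
elim: s => [|x s IHs]; first by rewrite big_nil scale1r.
by rewrite big_cons IHs /monomial -scalerAl -scalerAr scalerA -!exprD.
Qed.

Lemma coef_sum_monomial c (L : seq (seq mpart)) n :
  (\sum_(s <- L) \prod_(x <- s) monomial c x)`_n =
  \sum_(s <- L | weight s == n) (-1) ^+ count c s.
Proof.
rewrite coef_sum [RHS]big_mkcond; apply: eq_bigr => s _.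
by rewrite prod_monomial coefZ coefXn eq_sym; case: eqP; rewrite ?mulr1 ?mulr0.
Qed.

(** * Congruences modulo a power of ['X], and the products (q^2;q^2)_m *)

Definition eqmodX (m : nat) (f g : {poly rat}) : bool := ('X^m %| f - g)%R.

Lemma eqmodX_refl m f : eqmodX m f f.
Proof. by rewrite /eqmodX subrr dvdp0. Qed.

Lemma eqmodX_sym m f g : eqmodX m f g -> eqmodX m g f.
Proof. by rewrite /eqmodX -opprB dvdpNr. Qed.

Lemma eqmodX_trans m g f h : eqmodX m f g -> eqmodX m g h -> eqmodX m f h.
Proof. by move=> fg gh; rewrite /eqmodX -(subrKA g) dvdp_add. Qed.

Lemma eqmodXM m f g f' g' : eqmodX m f g -> eqmodX m f' g' -> eqmodX m (f * f') (g * g').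
Proof.
move=> fg fg'; rewrite /eqmodX.
have -> : f * f' - g * g' = (f - g) * f' + g * (f' - g') by ring.
by apply: dvdp_add; [exact: dvdp_mulr | exact: dvdp_mull].
Qed.

Lemma eqmodX_leq m k f g : (k <= m)%N -> eqmodX m f g -> eqmodX k f g.
Proof. by move=> km; apply: dvdp_trans; rewrite dvdp_exp2l. Qed.

Lemma eqmodX_sum m (I : Type) (r : seq I) (P : pred I) (F G : I -> {poly rat}) :
  (forall i, P i -> eqmodX m (F i) (G i)) ->
  eqmodX m (\sum_(i <- r | P i) F i) (\sum_(i <- r | P i) G i).
Proof.
move=> FG; rewrite /eqmodX -sumrB.
by elim/big_rec: _ => [|i f Pi mf]; rewrite ?dvdp0 // dvdp_add //; exact: FG.
Qed.

Lemma eqmodX_prod m (I : Type) (r : seq I) (P : pred I) (F G : I -> {poly rat}) :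
  (forall i, P i -> eqmodX m (F i) (G i)) ->
  eqmodX m (\prod_(i <- r | P i) F i) (\prod_(i <- r | P i) G i).
Proof.
move=> FG; elim/big_rec2: _ => [|i f g Pi fg]; first exact: eqmodX_refl.
by apply: eqmodXM => //; apply: FG.
Qed.

(** A polynomial with nonzero constant term is coprime to ['X], hence to its powers. *)
Lemma eqmodX_cancel m f g h : h.[0] != 0 -> eqmodX m (f * h) (g * h) -> eqmodX m f g.
Proof.
move=> h0; rewrite /eqmodX -mulrBl Gauss_dvdpl // coprimep_expl //.
by rewrite coprimep_sym -['X]subr0 -[0 in X in _ X]polyC0 coprimep_XsubC.
Qed.

Lemma eqmodX_coef m f g i : (i < m)%N -> eqmodX m f g -> f`_i = g`_i.
Proof.
move=> im /dvdpP[h fgh]; apply/eqP; rewrite -subr_eq0 -coefB fgh.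
by rewrite coefMXn im.
Qed.

Lemma horner0_prod (I : Type) (r : seq I) (F : I -> {poly rat}) :
  (forall i, (F i).[0] = 1) -> (\prod_(i <- r) F i).[0] = 1.
Proof. by move=> F1; rewrite horner_prod big1. Qed.

(* The finite product (q^2;q^2)_m. *)
Definition evens (m : nat) : {poly rat} := \prod_(j < m) (1 - 'X^(j.*2.+2)).

Lemma evensS m : evens m.+1 = evens m * (1 - 'X^(m.*2.+2)).
Proof. by rewrite /evens big_ord_recr. Qed.

Lemma evens0 m : (evens m).[0] = 1.
Proof. by apply: horner0_prod => j; rewrite !hornerE expr0n subr0. Qed.

(** Each factor of index at least [a] is 1 modulo ['X^(a.*2.+2)]. *)
Lemma evens_stable a b : (a <= b)%N -> eqmodX a.*2.+2 (evens b) (evens a).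
Proof.
move=> /subnKC <-; elim: (b - a)%N => [|k IHk]; first by rewrite addn0 eqmodX_refl.
rewrite addnS evensS; apply: eqmodX_trans IHk.
rewrite -{2}[evens _]mulr1; apply: eqmodXM; first exact: eqmodX_refl.
by rewrite /eqmodX addrAC subrr sub0r dvdpNr dvdp_exp2l //; lia.
Qed.

(** * Gaussian binomial coefficients and the q-binomial theorem *)

(** The Gaussian binomial coefficient in base [p], given by its Pascal recurrence so that no
    division occurs. *)
Fixpoint qbin (R : pzRingType) (p : R) (n k : nat) : R :=
  match n, k with
  | _, 0 => 1
  | 0, _.+1 => 0
  | n'.+1, k'.+1 => qbin R p n' k'.+1 + p ^+ (n' - k') * qbin R p n' k'
  end.
Arguments qbin : simpl never.

Lemma qbinS (R : pzRingType) (p : R) n k :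
  qbin R p n.+1 k.+1 = qbin R p n k.+1 + p ^+ (n - k) * qbin R p n k.
Proof. by []. Qed.

Lemma qbin0 (R : pzRingType) (p : R) n : qbin R p n 0 = 1.
Proof. by case: n. Qed.

Lemma qbin_small (R : pzRingType) (p : R) n k : (n < k)%N -> qbin R p n k = 0.
Proof.
elim: n k => [|n IHn] [|k] // nk; rewrite ?qbinS ?IHn ?mulr0 ?addr0 //; lia.
Qed.

(** The homogeneous form, with [y], lets the triple product be reached without negative powers of q.
    The induction regroups by the recurrence of [qbin]. *)
Lemma qbinomial_theorem (R : comPzRingType) (p x y : R) n :
  \prod_(i < n) (y + x * p ^+ i) =
  \sum_(k < n.+1) p ^+ 'C(k, 2) * qbin R p n k * x ^+ k * y ^+ (n - k).
Proof.
elim: n => [|n IHn]; first by rewrite big_ord0 big_ord1 /= !mulr1.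
rewrite big_ord_recr /= IHn mulrDr !big_distrl /= [RHS]big_ord_recl [X in X + _ = _]big_ord_recl /=.
rewrite !qbin0 -addrA; congr (_ + _).
  by rewrite !subn0 exprSr !mulrA.
under [RHS]eq_bigr => i _ do
  rewrite -[bump 0 i]/(i.+1) subSS qbinS mulrDr !mulrDl.
rewrite big_split; congr (_ + _) => /=.
  rewrite [RHS]big_ord_recr /= qbin_small // mulr0 !mul0r addr0.
  apply: eq_bigr => i _; rewrite -mulrA -exprSr; congr (_ * _ ^+ _).
  by rewrite -[bump 0 i]/(i.+1); have := ltn_ord i; lia.
apply: eq_bigr => i _; rewrite binS bin1 exprD exprS.
have -> : p ^+ n = p ^+ i * p ^+ (n - i) by rewrite -exprD subnKC // -ltnS.
by ring.
Qed.

(** The quotient formula with denominators cleared. In the double induction the two Pascal terms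
    contribute 1 - q^(2b+2) and q^(2b+2) (1 - q^(2a+2)), which add up to 1 - q^(2a+2b+4). *)
Lemma qbin_evens a b : qbin _ ('X^2 : {poly rat}) (a + b) a * evens a * evens b = evens (a + b).
Proof.
elim: a b => [|a IHa] b; first by rewrite qbin0 /evens big_ord0 !mul1r.
elim: b => [|b IHb].
  have e0 : evens 0 = 1 by rewrite /evens big_ord0.
  have := IHa 0%N; rewrite !addn0 e0 !mulr1 => h.
  by rewrite qbinS qbin_small // add0r subnn mul1r evensS mulrA h.
have {}IHa := IHa b.+1; rewrite addSnnS in IHb.
rewrite addSn qbinS addKn [RHS]evensS 2!mulrDl.
rewrite [X in X + _ = _](_ : _ = evens (a + b.+1) * (1 - 'X^(b.*2.+2))); last first.
  by rewrite -IHb [evens b.+1]evensS !mulrA.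
rewrite [X in _ + X = _](_ : _ = evens (a + b.+1) * ('X^(b.*2.+2) * (1 - 'X^(a.*2.+2)))); last first.
  rewrite -IHa -exprM (_ : (2 * b.+1 = b.*2.+2)%N); last by lia.
  by rewrite [evens a.+1]evensS; ring.
rewrite -mulrDr; congr (_ * _); rewrite mulrBr mulr1 -exprD addrA subrK.
by congr (1 - 'X^_); lia.
Qed.

(** Here d = n - |k - n| is the minimum of k and 2n - k. All indices involved are at least d, so
    every [evens] factor agrees with [evens d] to the stated order. *)
Lemma qbin_evens_eqmod n k : (k <= n.*2)%N ->
  eqmodX (n - `|k - n|)%N.*2.+2 (qbin _ 'X^2 n.*2 k * evens n) 1.
Proof.
move=> kn; set d := (n - _)%N.
have dn : (d <= n)%N by rewrite /d; lia.
have dk : (d <= k)%N by rewrite /d; lia.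
have dnk : (d <= n.*2 - k)%N by rewrite /d; lia.
have h := qbin_evens k (n.*2 - k); rewrite subnKC // in h.
apply: (@eqmodX_cancel _ _ _ (evens d)); first by rewrite evens0.
rewrite mul1r; apply: (@eqmodX_trans _ (evens n.*2)); last first.
  by apply: evens_stable; lia.
rewrite -h; apply: eqmodXM.
  apply: eqmodXM; first exact: eqmodX_refl.
  exact: eqmodX_trans (evens_stable _ _ dn) (eqmodX_sym _ _ _ (evens_stable _ _ dk)).
exact/eqmodX_sym/evens_stable.
Qed.

(** * Finite triple product, theta series and Euler's identity *)

Lemma finite_triple_product n :
  (\prod_(j < n) (1 + 'X^(j.*2.+1))) ^+ 2 =
  \sum_(k < n.*2.+1) qbin _ ('X^2 : {poly rat}) n.*2 k * 'X^(`|k - n| ^ 2).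
Proof.
(* In the q-binomial theorem for base 'X^2, take x = 'X and y = 'X^(2n): the
   factors i < n contribute 'X^(2i+1), the others 'X^(2n). *)
apply: (@mulfI _ ('X^(3 * n ^ 2))); first by rewrite monic_neq0 ?monicXn.
have := qbinomial_theorem _ ('X^2 : {poly rat}) 'X 'X^(n.*2) n.*2.
rewrite [LHS](_ : _ = \prod_(i < n + n) ('X^(n.*2) + 'X * 'X^2 ^+ i)); last by rewrite addnn.
rewrite big_split_ord /=.
rewrite [X in X * _](_ : _ = 'X^(n ^ 2) * \prod_(j < n) (1 + 'X^(j.*2.+1))); last first.
  have -> : 'X^(n ^ 2) = \prod_(j < n) 'X^(j.*2.+1) :> {poly rat}.
    elim: n => [|n IHn]; first by rewrite big_ord0.
    by rewrite big_ord_recr /= -IHn -exprD; congr 'X^_; lia.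
  (* Taking q^(2i+1) out of q^(2n) + q^(2i+1) leaves 1 + q^(2(n-1-i)+1), hence the reversal of the
     index. *)
  rewrite [X in _ = _ * X](reindex_inj rev_ord_inj) -big_split; apply: eq_bigr => i _ /=.
  rewrite mulrDr mulr1 -exprD -exprM -exprS addrC.
  by congr ('X^_ + 'X^_); have := ltn_ord i; lia.
rewrite [X in _ * X = _](_ : _ = 'X^(n.*2 * n) * \prod_(j < n) (1 + 'X^(j.*2.+1))); last first.
  have -> : 'X^(n.*2 * n) = \prod_(j < n) 'X^(n.*2) :> {poly rat}.
    by rewrite prodr_const card_ord exprM.
  rewrite -big_split; apply: eq_bigr => i _ /=.
  rewrite mulrDr mulr1 -exprD -exprM -exprS.
  by congr ('X^_ + 'X^_); lia.
move=> h; have -> : (3 * n ^ 2 = n ^ 2 + n.*2 * n)%N by lia.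
rewrite exprD expr2 mulrACA [X in X = _]h big_distrr; apply: eq_bigr => k _ /=.
rewrite -!exprM -exprD -[RHS]mulrCA -exprD mulrAC [_ * qbin _ _ _ _]mulrC -!mulrA -!exprD.
(* The exponents agree: k(k-1) + k + 2n(2n-k) = 3n^2 + (k-n)^2. *)
congr (_ * 'X^_).
have hk : ('C(k, 2) * 2 = k * k.-1)%N by have := bin_ffact k 2; rewrite ffactnS ffactn1.
have := ltn_ord k; rewrite ltnS => kn.
have [kn'|kn'] := leqP k n; nia.
Qed.

(** With r = |k - n|, the error in the k-th term is divisible by q to the power r^2 + 2(n-r) + 2 =
    (r-1)^2 + 2n + 1, which exceeds n. *)
Lemma theta_eqmod n :
  eqmodX n.+1 ((\prod_(j < n) (1 + 'X^(j.*2.+1))) ^+ 2 * evens n)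
              (\sum_(k < n.*2.+1) 'X^(`|k - n| ^ 2)).
Proof.
rewrite finite_triple_product big_distrl; apply: eqmodX_sum => k _ /=.
have := qbin_evens_eqmod n k; rewrite -ltnS ltn_ord => /(_ isT).
set d := absz _ => /dvdpP[h hE]; rewrite /eqmodX -['X^_ in X in _ - X]mul1r mulrAC -mulrBl hE.
rewrite -mulrA -exprD dvdp_mull // dvdp_exp2l //.
have : (d <= n)%N by rewrite /d; have := ltn_ord k; lia.
nia.
Qed.

(** Multiplying by (q^2;q^2)_n and pairing 1 - q^i with 1 + q^i turns the left side into
    (q^2;q^2)_(2n), which is congruent to (q^2;q^2)_n. *)
Lemma euler_eqmod n :
  eqmodX n.+1 (\prod_(j < n) (1 + 'X^(j.*2.+1)) * \prod_(j < n) (1 + 'X^(j.*2.+2)) *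
               \prod_(j < n) (1 - 'X^(j.*2.+1))) 1.
Proof.
apply: (@eqmodX_cancel _ _ _ (evens n)); first by rewrite evens0.
rewrite mul1r [X in eqmodX _ X](_ : _ = evens n.*2); last first.
  rewrite /evens -!big_split /=; elim: n => [|n IHn]; first by rewrite !big_ord0.
  rewrite doubleS !big_ord_recr /= IHn -[RHS]mulrA; congr (_ * _).
  rewrite (_ : n.*2.+1.*2.+2 = n.*2.+2 + n.*2.+2)%N; last by lia.
  rewrite (_ : n.*2.*2.+2 = n.*2.+1 + n.*2.+1)%N; last by lia.
  by rewrite !exprD; ring.
by apply: eqmodX_leq (evens_stable _ _ _); lia.
Qed.

Lemma coef_theta n : (0 < n)%N ->
  (\sum_(k < n.*2.+1) 'X^(`|k - n| ^ 2) : {poly rat})`_n =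
  (if [exists k : 'I_n.+1, n == k ^ 2]%N then 2 else 0).
Proof.
move=> n0; rewrite coef_sum; under eq_bigr => k _ do rewrite coefXn.
case: existsP => [[[k /= kn] /eqP nk]|h]; last first.
  apply: big1 => k _; case: eqP => // nk; case: h.
  have kn : (`|k - n| < n.+1)%N by have := ltn_ord k; lia.
  by exists (Ordinal kn); apply/eqP.
(* A positive root makes n - k and n + k two distinct indices, and these are the only ones that
   contribute. *)
have k0 : (0 < k)%N by nia.
have k1 : (n - k < n.*2.+1)%N by lia.
have k2 : (n + k < n.*2.+1)%N by lia.
rewrite (bigD1 (Ordinal k1)) // (bigD1 (Ordinal k2)) /=; last first.
  by rewrite -val_eqE /=; lia.
have sq a b : (a ^ 2 == b ^ 2)%N = (a == b) by rewrite eqn_sqr.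
rewrite big1 => [|i].
  have -> : (`|(n - k)%N - n| = k)%N by lia.
  have -> : (`|(n + k)%N - n| = k)%N by lia.
  by rewrite -nk eqxx addr0.
rewrite -!val_eqE /= => /andP[i1 i2]; case: (n =P _) => // ni.
by have := sq k `|i - n|%N; rewrite -nk -ni eqxx => /esym/eqP; lia.
Qed.

(** * Blocks and lists for the two families of partitions *)

(** [strict_ge] combines order and distinctness, and [over_ge] combines order and the overlining
    rule, each into one pairwise relation as the layered lists require. *)
Definition strict_ge (x y : mpart) : bool :=
  (y.1 < x.1)%N || [&& x.1 == y.1, x.2 == blue & y.2 == green].

Definition over_ge (x y : mpart) : bool :=
  (y.1 <= x.1)%N && (y.2 ==> (x.1 != y.1)).

Definition color_ok (x : mpart) : bool := ~~ odd x.1 ==> (x.2 == blue).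

Definition two_color_blocks (i : nat) : seq (seq mpart) :=
  if odd i then [:: [::]; [:: (i, green)]; [:: (i, blue)]; [:: (i, blue); (i, green)]]
  else [:: [::]; [:: (i, blue)]].

(* Multiplicities are cut off at m: only congruences modulo 'X^m.+1 survive. *)
Definition over_blocks (m i : nat) : seq (seq mpart) :=
  if odd i then [::] :: [seq (i, c) :: nseq k (i, false) | c <- [:: true; false], k <- iota 0 m]
  else [:: [::]].

Lemma size_le_weight s : all (fun x : mpart => 0 < x.1)%N s -> (size s <= weight s)%N.
Proof. by elim: s => //= x s IHs /andP[x0 /IHs s_le]; rewrite -add1n leq_add. Qed.

Lemma part_le_weight s : all (fun x : mpart => x.1 <= weight s)%N s.
Proof.
elim: s => //= x s IHs; rewrite leq_addr; apply: sub_all IHs => y ys.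
exact: leq_trans ys (leq_addl _ _).
Qed.

Lemma pairwise_strict_ge s : pairwise strict_ge s = sorted mpart_ge s && uniq s.
Proof.
have trS : transitive strict_ge.
  move=> y x z; rewrite /strict_ge /blue /green.
  by case: x.2 y.2 z.2 => [] [] []; rewrite ?andbF ?andbT ?orbF //; lia.
have trG : transitive mpart_ge.
  move=> y x z; rewrite /mpart_ge /blue /green.
  by case: x.2 y.2 z.2 => [] [] []; rewrite ?andbF ?andbT ?orbF //; lia.
rewrite (sorted_pairwise trG) uniq_pairwise -pairwise_relI.
apply: eq_pairwise => -[a c] [b d]; rewrite /strict_ge /mpart_ge /= xpair_eqE /blue /green.
by case: c d => [] []; rewrite ?andbF ?andbT ?orbF //=; lia.
Qed.

Lemma two_color_blocks_homog i b : b \in two_color_blocks i -> homogeneous i b.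
Proof.
rewrite /two_color_blocks; case: ifP => _; rewrite !inE.
  by case/or4P => /eqP-> /=; rewrite ?eqxx.
by case/orP => /eqP-> /=; rewrite ?eqxx.
Qed.

Lemma over_blocks_homog m i b : b \in over_blocks m i -> homogeneous i b.
Proof.
rewrite /over_blocks; case: ifP => _; last by rewrite inE => /eqP->.
  rewrite inE => /predU1P[->|] //.
by case/allpairsP => -[c k] /= [_ _ ->]; rewrite /homogeneous /= eqxx all_nseq eqxx orbT.
Qed.

Lemma two_color_blocks_uniq i : uniq (two_color_blocks i).
Proof.
rewrite /two_color_blocks /green /blue; case: ifP => _ //=; rewrite !inE.
by rewrite !eqseq_cons !xpair_eqE !andbF.
Qed.

Lemma over_blocks_uniq m i : uniq (over_blocks m i).
Proof.
rewrite /over_blocks; case: ifP => // _; rewrite cons_uniq; apply/andP; split.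
  by apply/negP => /allpairsP[[c k] []].
apply: allpairs_uniq; rewrite ?iota_uniq // => -[c k] [d l] _ _ /= [-> /(congr1 size)].
by rewrite !size_nseq => ->.
Qed.

Lemma two_color_blocksP i b : homogeneous i b -> pairwise strict_ge b -> all color_ok b ->
  b \in two_color_blocks i.
Proof.
case: b => [|[j c] [|[k d] [|[l e] b]]] /=.
- by rewrite /two_color_blocks; case: ifP.
- rewrite /color_ok /two_color_blocks /= !andbT => /eqP -> _.
  by case: odd c => [] [] //= _; rewrite !inE eqxx ?orbT.
- rewrite !andbT => /andP[/eqP -> /eqP ->]; rewrite /strict_ge /color_ok /= ltnn eqxx /=.
  move=> /andP[/eqP -> /eqP ->]; rewrite /two_color_blocks; case: odd => //= _.
  by rewrite !inE eqxx ?orbT.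
(* Among three parts of equal size, the second would have to be both green and blue. *)
case/and4P=> /eqP -> /eqP -> /eqP -> _ /and3P[/andP[h1 _] /andP[h2 _] _].
by move: h1 h2; rewrite /strict_ge /= ltnn eqxx /=; case: d => //; rewrite andbF.
Qed.

(** Only the first of several equal parts can be overlined, so a nonempty block is a head with mark
    [c] followed by plain copies. *)
Lemma over_blocksP m i b : homogeneous i b -> pairwise over_ge b ->
  all (fun x => odd x.1) b -> (size b <= m)%N -> b \in over_blocks m i.
Proof.
case: b => [|[j c] b] /=; first by rewrite /over_blocks; case: ifP.
case/andP=> /eqP -> bi /andP[cb _] /andP[oi _] bm; rewrite /over_blocks oi inE; apply/orP; right.
apply/allpairsP; exists (c, size b) => /=.
split; [by case: c {cb}; rewrite !inE | by rewrite mem_iota |].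
congr (_ :: _); apply/all_pred1P; apply/allP => -[k d] kb.
have /eqP /= -> := allP bi _ kb; have := allP cb _ kb.
have /eqP /= -> := allP bi _ kb.
by rewrite /over_ge /= eqxx /= implybF => /andP[_]; rewrite /= xpair_eqE eqxx; case: d {kb}.
Qed.

(* The bound n.*2 on the parts, rather than n, splits the product over part
   sizes exactly into n odd and n even factors. *)
Definition E_list n := layered two_color_blocks n.*2.

Definition over_list n := layered (over_blocks n) n.*2.

Lemma parts_of_bounds n s : parts_of n s ->
  all (fun x : mpart => 0 < x.1 <= n.*2)%N s /\ (size s <= n)%N.
Proof.
case/andP=> s0 /eqP sn; split; last by rewrite -sn; exact: size_le_weight.
have := part_le_weight s; rewrite /weight sn => sn'.
rewrite (@eq_all _ _ (predI (fun x : mpart => 0 < x.1)%N (fun x : mpart => x.1 <= n.*2)%N)) //.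
rewrite all_predI s0; apply: sub_all sn' => x xn; apply: leq_trans xn _.
by rewrite -addnn leq_addr.
Qed.

Lemma mem_E_list n s : is_E_partition n s -> s \in E_list n.
Proof.
case/and3P=> /andP[sn ss] us cs; have [sN szs] := parts_of_bounds _ _ sn.
apply: (@mem_layered _ strict_ge _ color_ok n) => //.
- by move=> x y /orP[/ltnW //|/and3P[/eqP-> _ _]].
- by move=> i b hb pb cb _ _; exact: two_color_blocksP.
- by rewrite pairwise_strict_ge ss.
Qed.

(** Order, distinctness and coloring are built into the blocks, so only the weight remains to be
    tested. *)
Lemma E_listP n s : s \in E_list n -> is_E_partition n s = (weight s == n).
Proof.
move=> sL; rewrite /is_E_partition /is_two_color_partition /parts_of.
have s0 : all (fun x : mpart => 0 < x.1)%N s.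
  by apply: sub_all (layered_le two_color_blocks_homog _ _ sL) => x /andP[].
have ps : pairwise strict_ge s.
  apply: (@layered_pairwise _ two_color_blocks_homog _ _ _ _ _ sL).
    by move=> x y xy; rewrite /strict_ge xy.
  move=> i b; rewrite /two_color_blocks; case: ifP => _; rewrite !inE.
    by case/or4P => /eqP-> //=; rewrite /strict_ge /= eqxx orbT.
  by case/orP => /eqP->.
have cs : all color_ok s.
  apply: (@layered_all two_color_blocks _ _ _ _ sL).
  move=> i b; rewrite /two_color_blocks; case: ifP => oi; rewrite !inE.
    by case/or4P => /eqP-> //=; rewrite /color_ok /= oi.
  by case/orP => /eqP-> //=; rewrite /color_ok /= oi.
move: ps; rewrite pairwise_strict_ge => /andP[-> ->].
by rewrite s0 [all _ s]cs !andbT.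
Qed.

Lemma is_overpartitionE n s : is_overpartition n s = parts_of n s && pairwise over_ge s.
Proof.
rewrite /is_overpartition (@sorted_pairwise _ geq); last by move=> x y z xy yz; exact: leq_trans yz xy.
by rewrite pairwise_map -pairwise_relI.
Qed.

Lemma mem_over_list n s :
  is_overpartition n s && all (fun x : mpart => odd x.1) s -> s \in over_list n.
Proof.
rewrite is_overpartitionE -andbA => /and3P[sn ps os]; have [sN szs] := parts_of_bounds _ _ sn.
apply: (@mem_layered _ over_ge _ (fun x => odd x.1) n) => //.
- by move=> x y /andP[].
- by move=> i b hb pb ob sb _; exact: over_blocksP.
Qed.

Lemma over_listP n s : s \in over_list n ->
  is_overpartition n s && all (fun x : mpart => odd x.1) s = (weight s == n).
Proof.
move=> sL; rewrite is_overpartitionE /parts_of.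
have s0 : all (fun x : mpart => 0 < x.1)%N s.
  by apply: sub_all (layered_le (over_blocks_homog n) _ _ sL) => x /andP[].
have ps : pairwise over_ge s.
  apply: (@layered_pairwise _ (over_blocks_homog n) _ _ _ _ _ sL).
    by move=> x y xy; rewrite /over_ge ltnW //= gtn_eqF ?implybT.
  move=> i b; rewrite /over_blocks; case: ifP => _; last by rewrite inE => /eqP->.
  rewrite inE => /predU1P[->|] //.
  case/allpairsP=> -[c k] /= [_ _ ->] /=; rewrite all_nseq /over_ge /= leqnn orbT /=.
  by elim: k => //= k ->; rewrite all_nseq /= leqnn orbT.
have os : all (fun x : mpart => odd x.1) s.
  apply: (@layered_all (over_blocks n) _ _ _ _ sL).
  move=> i b; rewrite /over_blocks; case: ifP => oi; last by rewrite inE => /eqP->.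
  rewrite inE => /predU1P[->|] //.
  by case/allpairsP=> -[c k] /= [_ _ ->] /=; rewrite all_nseq /= oi orbT.
by rewrite s0 ps os !andbT.
Qed.

(** * Generating polynomials of the two lists *)

Lemma sum_two_color_block (c : pred mpart) i :
    (forall d, odd i -> c (i, d) = false) ->
  \sum_(b <- two_color_blocks i) \prod_(x <- b) monomial c x =
  if odd i then (1 + 'X^i) ^+ 2 else 1 + (-1) ^+ c (i, blue) *: 'X^i.
Proof.
move=> ci; rewrite /two_color_blocks; case: ifP => oi.
  rewrite !big_cons !big_nil /monomial !ci //= expr0 !scale1r.
  by ring.
by rewrite !big_cons !big_nil /monomial /= mulr1 addr0.
Qed.

Lemma prod_double (F : nat -> {poly rat}) n :
  \prod_(i < n.*2) F i.+1 = \prod_(j < n) F j.*2.+1 * \prod_(j < n) F j.*2.+2.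
Proof.
elim: n => [|n IHn]; first by rewrite !big_ord0 mulr1.
by rewrite doubleS !big_ord_recr /= IHn; ring.
Qed.

Lemma sum_E_list (c : pred mpart) n :
    (forall i d, odd i -> c (i, d) = false) ->
  \sum_(s <- E_list n) \prod_(x <- s) monomial c x =
  (\prod_(j < n) (1 + 'X^(j.*2.+1))) ^+ 2 *
  \prod_(j < n) (1 + (-1) ^+ c (j.*2.+2, blue) *: 'X^(j.*2.+2)).
Proof.
move=> ci; rewrite sum_layered.
pose F i : {poly rat} := if odd i then (1 + 'X^i) ^+ 2 else 1 + (-1) ^+ c (i, blue) *: 'X^i.
rewrite (eq_bigr (fun i : 'I__ => F i.+1)) => [|i _]; last first.
  by rewrite sum_two_color_block // => d; exact: ci.
rewrite prod_double -prodrXl; congr (_ * _); apply: eq_bigr => j _.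
  by rewrite /F /= odd_double.
by rewrite /F /= odd_double.
Qed.

(** The block sum is the truncated series 1 + 2(q^i + ... + q^(im)), which telescopes against 1 -
    q^i. *)
Lemma sum_over_block m i : odd i ->
  (\sum_(b <- over_blocks m i) \prod_(x <- b) monomial pred0 x) * (1 - 'X^i) =
  1 + 'X^i - 2 * 'X^(i * m.+1).
Proof.
move=> oi; rewrite /over_blocks oi big_cons big_nil big_allpairs_dep /= !big_cons big_nil addr0.
have mk d k : \prod_(x <- (i, d) :: nseq k (i, false)) monomial pred0 x = 'X^(i * k.+1).
  rewrite prod_monomial count_pred0 scale1r /weight /= map_nseq sumn_nseq /=.
  by rewrite mulnS.
under eq_bigr => k _ do rewrite mk.
under [X in _ + (_ + X)]eq_bigr => k _ do rewrite mk.
rewrite -mulr2n -[m in iota 0 m]subn0 big_mkord.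
elim: m => [|m IHm]; first by rewrite big_ord0 muln1; ring.
rewrite big_ord_recr /= mulrnDl addrA mulrDl IHm.
by rewrite [(i * m.+2)%N]mulnS exprD; ring.
Qed.

(** Even sizes contribute 1. For odd i the truncation error is a multiple of q^(i(n+1)), which
    vanishes modulo q^(n+1). *)
Lemma sum_over_list_eqmod n :
  eqmodX n.+1 ((\sum_(s <- over_list n) \prod_(x <- s) monomial pred0 x) *
               \prod_(j < n) (1 - 'X^(j.*2.+1)))
              (\prod_(j < n) (1 + 'X^(j.*2.+1))).
Proof.
rewrite sum_layered (prod_double (fun i => \sum_(b <- over_blocks n i) \prod_(x <- b) monomial pred0 x)).
rewrite [X in _ * X * _]big1 ?mulr1 => [|j _]; last first.
  by rewrite /over_blocks /= odd_double big_seq1 big_nil.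
rewrite -big_split; apply: eqmodX_prod => j _ /=.
rewrite sum_over_block /= ?odd_double // /eqmodX addrAC subrr sub0r dvdpNr dvdp_mull //.
by rewrite dvdp_exp2l // mulSn leq_addr.
Qed.

(** * The counts of E-partitions: total, signed by even parts, and by parity of length *)

Lemma E_eq_pobar n : E n = pobar n.
Proof.
rewrite /E /pobar (@count_marked_enum _ _ (E_list n)); first last.
- exact: mem_E_list.
- by move=> s /andP[/andP[]].
- exact: layered_uniq two_color_blocks_homog _ two_color_blocks_uniq.
rewrite (@count_marked_enum _ _ (over_list n)); first last.
- exact: mem_over_list.
- by move=> s /andP[/andP[]].
- exact: layered_uniq (over_blocks_homog n) _ (over_blocks_uniq n).
rewrite (eq_in_count (@E_listP n)) (eq_in_count (@over_listP n)).
have cnt L : (count (fun s => weight s == n) L)%:R =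
    (\sum_(s <- L) \prod_(x <- s) monomial pred0 x)`_n.
  rewrite coef_sum_monomial -sum1_count natr_sum; apply: eq_bigr => s _.
  by rewrite count_pred0.
apply/eqP; rewrite -(Num.Theory.eqr_nat rat) !cnt; apply/eqP.
apply: (@eqmodX_coef n.+1) => //.
(* After multiplication by (q;q^2)_n the overpartition side is (-q;q^2)_n; the other side is the
   same polynomial times the product in Euler's identity. *)
apply: (@eqmodX_cancel _ _ _ (\prod_(j < n) (1 - 'X^(j.*2.+1)))).
  by rewrite horner0_prod ?oner_eq0 // => j; rewrite !hornerE expr0n subr0.
apply: eqmodX_trans (eqmodX_sym _ _ _ (sum_over_list_eqmod n)).
rewrite sum_E_list // expr2 -!mulrA; under [X in _ * (_ * (X * _))]eq_bigr => j _ do rewrite scale1r.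
rewrite -[X in eqmodX _ _ X]mulr1; apply: eqmodXM; first exact: eqmodX_refl.
by rewrite mulrA; exact: euler_eqmod.
Qed.

Lemma E_split n (P : pred (seq mpart)) :
  (count_marked n (fun s => is_E_partition n s && P s) +
   count_marked n (fun s => is_E_partition n s && ~~ P s) = E n)%N.
Proof.
rewrite /E /count_marked -[RHS](cardsID [set t | P (decode t)]).
congr (_ + _)%N; apply: eq_card => t; rewrite !inE //; exact: andbC.
Qed.

Lemma E0_sub_E1 n : (0 < n)%N ->
  (E0 n)%:R - (E1 n)%:R = (if [exists k : 'I_n.+1, n == k ^ 2]%N then 2 else 0) :> rat.
Proof.
move=> n0; rewrite -coef_theta // -(eqmodX_coef _ _ _ _ (ltnSn n) (theta_eqmod n)).
(* Signing the even parts turns their factors into 1 - q^(2j+2), so the theta congruence applies. *)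
pose c (x : mpart) := ~~ odd x.1.
have cE : \sum_(s <- E_list n) \prod_(x <- s) monomial c x =
    (\prod_(j < n) (1 + 'X^(j.*2.+1))) ^+ 2 * evens n.
  rewrite sum_E_list => [|i d oi]; last by rewrite /c oi.
  by congr (_ * _); apply: eq_bigr => j _; rewrite /c /= odd_double scaleN1r.
rewrite -cE coef_sum_monomial.
have EL P : count_marked n (fun s => is_E_partition n s && P s) =
    count (fun s => (weight s == n) && P s) (E_list n).
  rewrite (@count_marked_enum _ _ (E_list n)).
  - by apply: eq_in_count => s sL; rewrite E_listP.
  - exact: layered_uniq two_color_blocks_homog _ two_color_blocks_uniq.
  - by move=> s /andP[/andP[/andP[]]].
  - by move=> s /andP[/mem_E_list].
rewrite /E0 /E1 !EL -!sum1_count !natr_sum [RHS](bigID (fun s => odd (num_even_parts s))) /=.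
rewrite addrC; congr (_ + _).
  by apply: eq_bigr => s /andP[_ /negbTE]; rewrite -signr_odd => ->.
by rewrite -sumrN; apply: eq_bigr => s /andP[_]; rewrite -signr_odd => ->.
Qed.

(** Modulo 2, n is the number of odd parts. *)
Lemma E_odd_size n s : is_E_partition n s ->
  odd (size s) = odd n (+) odd (num_even_parts s).
Proof.
case/and3P=> /andP[/andP[_ /eqP<-] _] _ _; elim: s => //= x s ->; rewrite !oddD oddb.
by case: (odd x.1); case: (odd (sumn _)); case: (odd (num_even_parts s)).
Qed.

Lemma E2_parity n : E2 n = if odd n then E1 n else E0 n.
Proof.
case: ifP => on; apply: eq_card => t; rewrite !inE.
  by case Et: is_E_partition => //=; rewrite (E_odd_size _ _ Et) on negbK.
by case Et: is_E_partition => //=; rewrite (E_odd_size _ _ Et) on.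
Qed.

Lemma E3_parity n : E3 n = if odd n then E0 n else E1 n.
Proof.
case: ifP => on; apply: eq_card => t; rewrite !inE.
  by case Et: is_E_partition => //=; rewrite (E_odd_size _ _ Et) on.
by case Et: is_E_partition => //=; rewrite (E_odd_size _ _ Et) on.
Qed.

Theorem theorem1 :
  (forall n : nat, E n = pobar n) /\
  (forall n : nat, (0 < n)%N ->
    [/\ (perfect_square n -> (E0 n)%:R = (pobar n)%:R / 2 + 1 :> rat) /\
        (~ perfect_square n -> (E0 n)%:R = (pobar n)%:R / 2 :> rat),
        (perfect_square n -> (E1 n)%:R = (pobar n)%:R / 2 - 1 :> rat) /\
        (~ perfect_square n -> (E1 n)%:R = (pobar n)%:R / 2 :> rat),
        (perfect_square n -> (E2 n)%:R = (pobar n)%:R / 2 + (-1) ^+ n :> rat) /\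
        (~ perfect_square n -> (E2 n)%:R = (pobar n)%:R / 2 :> rat)
      & (perfect_square n -> (E3 n)%:R = (pobar n)%:R / 2 - (-1) ^+ n :> rat) /\
        (~ perfect_square n -> (E3 n)%:R = (pobar n)%:R / 2 :> rat)]).
Proof.
split=> [|n n0]; first exact: E_eq_pobar.
have sum01 : (E0 n)%:R + (E1 n)%:R = (pobar n)%:R :> rat.
  by rewrite -natrD addnC -E_eq_pobar (E_split n (fun s => odd (num_even_parts s))).
have := E0_sub_E1 _ n0; rewrite -sum01 E2_parity E3_parity -signr_odd.
(* The sum and difference of [E0 n] and [E1 n] determine both; their exchange for odd n accounts for
   the sign (-1)^n. *)
case: existsP => [[k /eqP nk]|nsq] dif.
  have sq : perfect_square n by exists k.
  by case: (odd n); split; split=> // _; rewrite ?expr1 ?expr0; lra.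
have nsq' : ~ perfect_square n.
  (* A root of n is at most n, so the bounded search misses no square. *)
  move=> [k nk]; apply: nsq; have kn : (k < n.+1)%N by nia.
  by exists (Ordinal kn); apply/eqP.
by case: (odd n); split; split=> // _; lra.
Qed.
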